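(* Let $n\ge2$ be an integer, $\sigma>0$, $\alpha,\beta\in(0,1)$, and $\mathcal{C}_n=\{[i/n,j/n]: i<j\text{ in }\{0,\dots,n\}\}$. Assume that $f:[0,1]\to\mathbb{R}$ (possibly depending on $n$) is continuously differentiable and that there exist an interval $[t_n-\Delta_n,t_n+\Delta_n]\subset[0,1]$ and positive numbers $M$, $\lambda_n$ and $\delta_n\le\Delta_n$ such that $$f'(t)\ge0\ \text{ on }[t_n-\Delta_n,t_n+\Delta_n],\qquad f'(t)\ge M\lambda_n\ \text{ on }[t_n-\delta_n,t_n+\delta_n].$$ Then there exists a positive number $C(\alpha,\beta)$, only depending on $\alpha$ and $\beta$, such that $$\mathbb{P}_f\Bigl[\max_{I\in\mathcal{C}_n}S_n^I>s_{\alpha,n}\Bigr]\ge1-\beta$$ provided $\Delta_n\ge1/n$ and $$\frac{M\delta_n^2\lambda_n}{\sqrt{\Delta_n}}\ge C(\alpha,\beta)\sqrt{\frac{\sigma^2\log n}{n}} .$$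
   Context: White noise model: for an integer $n$, a known $\sigma>0$ and an unknown integrable function $f:[0,1]\to\mathbb{R}$, one observes $$F_n(t)=\int_0^t f(x)\,dx+\frac{\sigma}{\sqrt n}W(t),\qquad t\in[0,1],$$ where $W$ is a standard Brownian motion on $[0,1]$ starting at $0$. $\mathbb{P}_f$ denotes probability when the unknown function is $f$. For a continuous function $G:[0,1]\to\mathbb{R}$ and a closed sub-interval $I\subset[0,1]$, $\hat G^I$ denotes the least concave majorant of the restriction of $G$ to $I$; $|I|$ is the length of $I$. Set $$S_n^I=\sqrt{\frac{n}{\sigma^2|I|}}\,\sup_{t\in I}\bigl(\hat F_n^I(t)-F_n(t)\bigr),$$ and let $s_{\alpha,n}$ be the $(1-\alpha)$-quantile of $\max_{I\in\mathcal{C}_n}\frac{1}{\sqrt{|I|}}\sup_{t\in I}\bigl(\hat W^I(t)-W(t)\bigr)$. ''Only depending on $\alpha$ and $\beta$'' means in particular that $C(\alpha,\beta)$ does not depend on $n$, $\sigma$, $f$, $M$, $t_n$, $\lambda_n$, $\delta_n$, $\Delta_n$. *)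

(* Defs.v *)
From HB Require Import structures.
From mathcomp Require Import all_boot all_order all_algebra.
From mathcomp Require Import all_classical all_reals all_analysis.

Set Implicit Arguments.
Unset Strict Implicit.
Unset Printing Implicit Defensive.

Import Order.TTheory GRing.Theory Num.Theory.
Import numFieldNormedType.Exports.

Local Open Scope classical_set_scope.
Local Open Scope ring_scope.

(* A closed interval [a, b] is given by its two endpoints, and a function on
   [0, 1] by a total function on R whose values off [0, 1] are irrelevant. *)

Section ConcaveMajorant.
Variable R : realType.
Implicit Types (a b t : R) (G h : R -> R).

Definition is_concave_majorant a b G h :=
  convex_function (`[a, b] : set R^o) (fun x : R^o => - h x : R^o) /\
  (forall x, x \in `[a, b] -> G x <= h x).

(* For G bounded on [a, b] (in particular continuous) the pointwise infimum of
   the concave majorants is itself a concave majorant, hence the least one. *)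
Definition least_concave_majorant a b G t : R :=
  inf [set h t | h in is_concave_majorant a b G].

Definition sup_gap a b G : R :=
  sup [set least_concave_majorant a b G t - G t | t in `[a, b]].

(* One-sided derivatives at the endpoints 0 and 1. *)
Definition C1_on01 (f f' : R -> R) :=
  {within `[0, 1], continuous f'} /\
  (forall t, t \in `[0, 1] ->
    (f y - f t) / (y - t) @[y --> within `[0, 1] (dnbhs t)] --> f' t).

End ConcaveMajorant.

Section GridMaximum.
Variable R : realType.

Definition grid_intervals (n : nat) : set (R * R) :=
  [set (ij.1%:R / n%:R, ij.2%:R / n%:R) |
    ij in [set ij : nat * nat | (ij.1 < ij.2 <= n)%N]].

(* The set is finite, and nonempty for 0 < n, so that sup is a maximum. *)
Definition grid_max (n : nat) (stat : R -> R -> R) : R :=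
  sup [set stat I.1 I.2 | I in grid_intervals n].

Definition S_stat (n : nat) (sigma : R) (F : R -> R) (a b : R) : R :=
  Num.sqrt (n%:R / (sigma ^+ 2 * (b - a))) * sup_gap a b F.

Definition noise_stat (w : R -> R) (a b : R) : R :=
  (Num.sqrt (b - a))^-1 * sup_gap a b w.

Definition observation (n : nat) (sigma : R) (f w : R -> R) (t : R) : R :=
  \int[lebesgue_measure]_(x in `[0, t]) f x + sigma / Num.sqrt n%:R * w t.

End GridMaximum.

Section Probability.
Context (R : realType) (d : measure_display) (T : measurableType d).
Variable P : probability T R.

(* Subfamilies are covered by taking some of the B i equal to setT. *)
Definition mutually_independent (k : nat) (X : 'I_k -> T -> R) :=
  forall B : 'I_k -> set R, (forall i, measurable (B i)) ->
    P (\bigcap_(i in [set: 'I_k]) (X i @^-1` B i)) =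
    (\prod_(i < k) P (X i @^-1` B i))%E.

(* W t w is the value at time t of the path w; only times in [0, 1] matter. *)
Record brownian_motion01 (W : R -> T -> R) : Prop := BrownianMotion01 {
  bm_measurable : forall t, t \in `[0, 1] -> measurable_fun setT (W t);
  bm_start : forall w, W 0 w = 0;
  bm_continuous : forall w, {within `[0, 1], continuous (W ^~ w)};
  bm_gaussian : forall s t, 0 <= s -> s < t -> t <= 1 ->
    forall B : set R, measurable B ->
    P ((fun w => W t w - W s w) @^-1` B) = normal_prob 0 (Num.sqrt (t - s)) B;
  bm_independent : forall (k : nat) (t : nat -> R),
    (forall i, t i \in `[0, 1]) -> (forall i, t i <= t i.+1) ->
    mutually_independent (fun i : 'I_k => fun w => W (t i.+1) w - W (t i) w) }.

Definition quantile (p : R) (X : T -> R) : R :=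
  inf [set x | (p%:E <= P [set w | (X w <= x)%R])%E].

Definition s_quantile (alpha : R) (n : nat) (W : R -> T -> R) : R :=
  quantile (1 - alpha) (fun w => grid_max n (noise_stat (W ^~ w))).

End Probability.

(* Main.v *)
Require Import Defs.
From HB Require Import structures.
From mathcomp Require Import all_boot all_order all_algebra.
From mathcomp Require Import all_classical all_reals all_analysis.
From mathcomp Require Import measurable_realfun zify ring lra.

Import Order.TTheory GRing.Theory Num.Theory.
Import numFieldNormedType.Exports.

Local Open Scope classical_set_scope.
Local Open Scope ring_scope.

Set Implicit Arguments.
Unset Strict Implicit.
Unset Printing Implicit Defensive.

(** Everything is expressed through chord gaps: for x <= t <= y, the amount
    (y - t) G x + (t - x) G y - (y - x) G t by which the chord of G over
    [x, y] exceeds G at t, scaled by y - x so that no division occurs.  Since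
    a concave majorant lies above every chord, sup_gap a b G dominates every
    normalised chord gap; conversely a supporting line shows that it is the
    supremum of them ([chord_gap_le_sup_gap], [sup_gap_le]).  By continuity
    rational triples suffice, which makes all the statistics measurable
    ([measurable_sup_gap]).

    Critical value.  On an interval of length L the increments of W over the
    dyadic cells of level k have standard deviation sqrt (L / 2 ^ k).  If each
    of them is at most r (3/4)^k, the series of increments leading to a dyadic
    point sums to at most 4 r, so W oscillates by at most 8 r over the
    interval and so does its gap ([chaining], [sup_gap_oscillation]).  As 3/4
    exceeds 1 / sqrt 2, the Gaussian tails beat the number 2 ^ k of cells, and
    the exceptional event has probability at most 4 exp (- u) when
    r = 2 sqrt (u L) ([bm_sup_gap_tail]).  A union bound over the at most
    (n + 1) ^ 2 grid intervals, with u a large multiple of ln n, bounds the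
    quantile by a constant times sqrt (ln n) ([s_quantile_le]).

    Power.  Some grid interval I contains [t - Delta, t + Delta] and has length
    at most 4 Delta ([grid_cover]).  At the triple (t - delta, t, t + delta)
    the normalised chord gap of the primitive of f is at least of order
    M lambda delta ^ 2, because f grows at rate M lambda there
    ([primitive_chord_gap]), while the chord gap of the noise involves only two
    increments of W over intervals of length delta.  Hence with probability at
    least 1 - beta the statistic of I exceeds
    sqrt n M lambda delta ^ 2 / (16 sigma sqrt Delta) - z, where z depends only
    on beta ([S_stat_ge]); this is above the critical value by the assumption
    on the signal ([signal_beats_threshold]). *)

(** * Chord gaps and least concave majorants *)

Section SupGap.
Local Open Scope convex_scope.
Variable R : realType.
Implicit Types (a b t x y c : R) (G h : R -> R).

Definition chord_gap G x t y : R :=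
  (y - t) * G x + (t - x) * G y - (y - x) * G t.

Lemma continuous_within_ltr (a b : R) G t v :
  {within `[a, b], continuous G} -> t \in `[a, b] -> G t < v ->
  exists2 e, 0 < e & forall x, x \in `[a, b] -> `|x - t| < e -> G x < v.
Proof.
move=> /subspace_continuousP /(_ t) cG tab Gv.
have cGt : G @ within `[a, b] (nbhs t) --> G t := cG tab.
have [e /= e0 He] := cvgr_lt _ cGt _ Gv.
exists e => // x xab xt; apply: He => //=.
by rewrite distrC.
Qed.

(** Continuity at t is what makes the slope finite even at an endpoint: below
    the level v near t, a bounded excess over v is absorbed by a steep line. *)
Lemma linear_growth_above a b G t v : a <= b ->
  {within `[a, b], continuous G} -> t \in `[a, b] -> G t < v ->
  exists2 B, 0 <= B & forall x, x \in `[a, b] -> G x - v <= B * `|x - t|.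
Proof.
move=> ab cG tab Gv.
have [e e0 He] := continuous_within_ltr cG tab Gv.
have [m _ Gm] := EVT_max ab cG.
exists (`|G m - v| / e); first by rewrite divr_ge0// ltW.
move=> x xab; have [xt|xt] := ltP `|x - t| e.
  apply: (@le_trans _ _ 0); first by rewrite subr_le0 ltW// He.
  by rewrite mulr_ge0// divr_ge0// ltW.
rewrite (@le_trans _ _ `|G m - v|)//.
  by rewrite (le_trans _ (ler_norm _))// lerD2r Gm.
by rewrite -mulrA ler_peMr// mulrC ler_pdivlMr ?mul1r.
Qed.

(** The slopes from (t, v) to points of the graph on the right are below the
    slopes from points on the left, by the chord hypothesis; any number in
    between supports the graph. *)
Lemma supporting_slope a b G t v : a <= b ->
  {within `[a, b], continuous G} -> t \in `[a, b] -> G t < v ->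
  (forall x y, x \in `[a, b] -> y \in `[a, b] -> x < t -> t < y ->
    (y - t) * G x + (t - x) * G y <= (y - x) * v) ->
  exists s, forall x, x \in `[a, b] -> G x <= v + s * (x - t).
Proof.
move=> ab cG tab Gv chords.
have [B B0 HB] := linear_growth_above ab cG tab Gv.
(* The lower bound - B of the left slopes keeps S nonempty at t = b. *)
pose S := [set - B] `|` [set (G y - v) / (y - t) | y in `]t, b]].
have slopeB y : y \in `[a, b] -> t < y -> (G y - v) / (y - t) <= B.
  move=> yab ty; rewrite ler_pdivrMr ?subr_gt0//.
  by rewrite (le_trans (HB y yab))// gtr0_norm ?subr_gt0.
have rightab y : y \in `]t, b] -> y \in `[a, b].
  move: tab; rewrite !in_itv/= => /andP[at_ _] /andP[/ltW ty ->].
  by rewrite (le_trans at_ ty).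
have ubS : has_ubound S.
  exists B => _ [->|[y ytb <-]]; first by lra.
  by apply: slopeB; [exact: rightab|move: ytb; rewrite /= in_itv/= => /andP[]].
exists (sup S) => x xab; have [xt|tx|->] := ltgtP x t.
- rewrite -lerBlDl -(opprB t x) mulrN lerNr opprB -ler_pdivlMr ?subr_gt0//.
  apply: ge_sup; first by exists (- B); left.
  move=> _ [->|[y ytb <-]].
    rewrite ler_pdivlMr ?subr_gt0// mulNr lerNl opprB.
    by rewrite (le_trans (HB _ xab))// ltr0_norm ?subr_lt0// opprB.
  have ty : t < y by move: ytb; rewrite /= in_itv/= => /andP[].
  rewrite ler_pdivlMr ?subr_gt0// mulrAC ler_pdivrMr ?subr_gt0//.
  have := chords x y xab (rightab _ ytb) xt ty; lra.
- rewrite -lerBlDl -ler_pdivrMr ?subr_gt0//.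
  apply: ub_le_sup => //; right; exists x => //=.
  by move: xab; rewrite !in_itv/= tx => /andP[].
- by rewrite subrr mulr0 addr0 ltW.
Qed.

Lemma affine_concave a b G v s t :
  (forall x, x \in `[a, b] -> G x <= v + s * (x - t)) ->
  is_concave_majorant a b G (fun x => v + s * (x - t)).
Proof.
move=> GL; split=> // p x y _ _.
have -> : (x : convex_lmodType R^o) <| p |> y =
  p%:inum * x + (1 - p%:inum) * y by [].
rewrite [leRHS](_ : _ = p%:inum * - (v + s * (x - t)) +
    (1 - p%:inum) * - (v + s * (y - t)))//.
by rewrite le_eqVlt; apply/orP; left; apply/eqP; ring.
Qed.

Lemma concave_majorant_chord a b G h x t y :
  is_concave_majorant a b G h -> a <= x -> x <= t -> t <= y -> y <= b ->
  (y - t) * G x + (t - x) * G y <= (y - x) * h t.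
Proof.
move=> [ch Gh] ax xt ty yb.
have xab : x \in `[a, b] by rewrite in_itv/= ax (le_trans xt)// (le_trans ty).
have yab : y \in `[a, b].
  by rewrite in_itv/= yb andbT (le_trans ax)// (le_trans xt).
have [xy|] := ltP x y; last first.
  move=> yx; have tx : t = x by apply/eqP; rewrite eq_le xt (le_trans ty yx).
  have -> : y = x by apply/eqP; rewrite eq_le yx -{1}tx ty.
  by rewrite tx !subrr !mul0r addr0.
have yx0 : 0 < y - x by rewrite subr_gt0.
have p01 : 0 <= (y - t) / (y - x) <= 1.
  rewrite divr_ge0 ?subr_ge0 ?(ltW xy)//= ler_pdivrMr// mul1r.
  by rewrite lerD2l lerN2.
pose p := Itv01 (proj1 (andP p01)) (proj2 (andP p01)).
have /(_ p x y) := ch; rewrite !inE/= => /(_ xab yab).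
have -> : (x : convex_lmodType R^o) <| p |> y =
  p%:inum * x + (1 - p%:inum) * y by [].
rewrite [leRHS](_ : _ = p%:inum * - h x + (1 - p%:inum) * - h y)//=.
have -> : (y - t) / (y - x) * x + (1 - (y - t) / (y - x)) * y = t.
  by field; rewrite gt_eqF.
move=> H; have Gx := Gh x xab; have Gy := Gh y yab.
have : (y - x) * ((y - t) / (y - x) * h x + (1 - (y - t) / (y - x)) * h y) <=
    (y - x) * h t.
  by rewrite ler_pM2l//; move: H; lra.
have -> : (y - x) * ((y - t) / (y - x) * h x + (1 - (y - t) / (y - x)) * h y)
    = (y - t) * h x + (t - x) * h y by field; rewrite gt_eqF.
apply: le_trans; apply: lerD; apply: ler_wpM2l; rewrite ?subr_ge0//.
Qed.

Lemma const_majorant a b G m : (forall x, x \in `[a, b] -> G x <= m) ->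
  is_concave_majorant a b G (fun=> m).
Proof.
move=> Gm; have := @affine_concave a b G m 0 0.
rewrite (_ : (fun x => _) = fun=> m); last first.
  by apply/funext => x; rewrite mul0r addr0.
by apply=> x /Gm; rewrite mul0r addr0.
Qed.

Lemma majorant_values_lbound a b G t : t \in `[a, b] ->
  has_lbound [set h t | h in is_concave_majorant a b G].
Proof. by move=> tab; exists (G t) => _ [h [_ Gh] <-]; exact: Gh. Qed.

Lemma chord_le_least_concave_majorant a b G x t y :
  a <= b -> {within `[a, b], continuous G} ->
  a <= x -> x <= t -> t <= y -> y <= b ->
  (y - t) * G x + (t - x) * G y <= (y - x) * least_concave_majorant a b G t.
Proof.
move=> ab cG ax xt ty yb.
have [xy|yx] := ltP x y; last first.
  have tx : t = x by apply/eqP; rewrite eq_le xt (le_trans ty yx).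
  have -> : y = x by apply/eqP; rewrite eq_le yx -{1}tx ty.
  by rewrite tx !subrr !mul0r addr0.
rewrite [leRHS]mulrC -ler_pdivrMr ?subr_gt0//; apply: lb_le_inf.
  have [m _ Gm] := EVT_max ab cG.
  by exists (G m), (fun=> G m) => //; exact: const_majorant.
move=> _ [h hG <-]; rewrite ler_pdivrMr ?subr_gt0// [leRHS]mulrC.
exact: concave_majorant_chord hG ax xt ty yb.
Qed.

Lemma chord_gap_le_sup_gap a b G x t y : a <= b ->
  {within `[a, b], continuous G} ->
  a <= x -> x <= t -> t <= y -> y <= b ->
  chord_gap G x t y <= (y - x) * sup_gap a b G.
Proof.
move=> ab cG ax xt ty yb.
have [m _ Gm] := EVT_max ab cG.
have [l _ Gl] := EVT_min ab cG.
have tab : t \in `[a, b] by rewrite in_itv/= (le_trans ax)// (le_trans ty).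
have gap_le : least_concave_majorant a b G t - G t <= sup_gap a b G.
  apply: ub_le_sup; last by exists t.
  exists (G m - G l) => _ [u uab <-]; apply: lerB; last exact: Gl.
  apply: ge_inf; first exact: majorant_values_lbound.
  by exists (fun=> G m) => //; exact: const_majorant.
have := ler_wpM2l _ gap_le => /(_ (y - x)).
rewrite subr_ge0 (le_trans xt ty) => /(_ isT); apply: le_trans.
by rewrite mulrBr /chord_gap lerB// chord_le_least_concave_majorant.
Qed.

Lemma sup_gap_ge0 a b G : a < b -> {within `[a, b], continuous G} ->
  0 <= sup_gap a b G.
Proof.
move=> ab cG.
have := chord_gap_le_sup_gap (ltW ab) cG (lexx a) (lexx a) (ltW ab) (lexx b).
by rewrite /chord_gap !subrr mul0r addr0 subrr pmulr_rge0 ?subr_gt0.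
Qed.

(** The converse of [chord_gap_le_sup_gap]: an affine function through
    (t, G t + c + e) supports the graph for every e > 0, hence is one of the
    majorants entering the infimum. *)
Lemma sup_gap_le a b G c : a <= b -> {within `[a, b], continuous G} ->
  0 <= c ->
  (forall x t y, a <= x -> x < t -> t < y -> y <= b ->
    chord_gap G x t y <= (y - x) * c) ->
  sup_gap a b G <= c.
Proof.
move=> ab cG c0 gaps; apply: ge_sup.
  exists (least_concave_majorant a b G a - G a), a => //=.
  by rewrite in_itv/= lexx.
move=> _ [t tab <-]; rewrite lerBlDr; apply/ler_addgt0Pr => e e0.
have Gv : G t < c + G t + e by lra.
have [|s Gs] := supporting_slope ab cG tab Gv.
  move=> x y; rewrite !in_itv/= => /andP[ax _] /andP[_ yb] xt ty.
  have := gaps x t y ax xt ty yb; rewrite /chord_gap => H.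
  have : 0 <= (y - x) * e by rewrite mulr_ge0 ?ltW// subr_gt0 (lt_trans xt ty).
  move: H; lra.
apply: ge_inf; first exact: majorant_values_lbound.
exists (fun x => c + G t + e + s * (x - t)); first exact: affine_concave.
by rewrite /= subrr mulr0 addr0.
Qed.

End SupGap.

(** * Measurability of the statistics *)

Section Dense.
Variable R : realType.
Implicit Types (a b t x y c : R) (G h : R -> R).

Lemma continuous_le_dense (D : set R) a b G c :
  a < b -> {within `[a, b], continuous G} ->
  (forall x y, a <= x -> x < y -> y <= b -> exists2 d, D d & x < d < y) ->
  (forall d, D d -> a < d -> d < b -> G d <= c) ->
  forall x, x \in `[a, b] -> G x <= c.
Proof.
move=> ab cG dD GD x xab; rewrite leNgt; apply/negP => cGx.
have cN : {within `[a, b], continuous (fun z => - G z)}.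
  by move=> z; apply: continuousN; exact: cG.
have [e e0 He] := continuous_within_ltr cN xab (etrans (ltrN2 _ _) cGx).
move: (xab); rewrite in_itv/= => /andP[ax xb].
have [|||d Dd] := dD (Num.max a (x - e)) (Num.min b (x + e)).
- by rewrite le_max lexx.
- by rewrite gt_max !lt_min ab/=; apply/andP; split; [|apply/andP; split]; lra.
- by rewrite ge_min lexx.
rewrite gt_max lt_min => /andP[/andP[ad xd] /andP[db dx]].
have /He : d \in `[a, b] by rewrite in_itv/= !ltW.
have -> : `|d - x| < e by rewrite ltr_distl xd.
by move=> /(_ isT); rewrite ltrN2 ltNge GD.
Qed.

Lemma within_continuous_chord a b G c x t y :
  {within `[a, b], continuous G} ->
  [/\ {within `[a, b], continuous (fun z => chord_gap G z t y - (y - z) * c)},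
      {within `[a, b], continuous (fun z => chord_gap G x z y - (y - x) * c)} &
      {within `[a, b], continuous (fun z => chord_gap G x t z - (z - x) * c)}].
Proof.
move=> cG.
have cid : {within `[a, b], continuous (fun z : R => z)}.
  by apply: continuous_subspaceT => z; exact: cvg_id.
have cc (k : R) : {within `[a, b], continuous (fun z : R => k)}.
  by apply: continuous_subspaceT => z; exact: cvg_cst.
have gap_cont (X Y Z GX GY GZ : R -> R) :
    {within `[a, b], continuous X} -> {within `[a, b], continuous Y} ->
    {within `[a, b], continuous Z} -> {within `[a, b], continuous GX} ->
    {within `[a, b], continuous GY} -> {within `[a, b], continuous GZ} ->
    {within `[a, b], continuous (fun z => (Z z - Y z) * GX z +
      (Y z - X z) * GZ z - (Z z - X z) * GY z - (Z z - X z) * c)}.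
  move=> cX cY cZ cGX cGY cGZ z.
  apply: cvgB; last first.
    by apply: cvgM; [apply: cvgB; [exact: cZ|exact: cX]|exact: cvg_cst].
  apply: cvgB; last first.
    by apply: cvgM; [apply: cvgB; [exact: cZ|exact: cX]|exact: cGY].
  apply: cvgD; apply: cvgM.
  - by apply: cvgB; [exact: cZ|exact: cY].
  - exact: cGX.
  - by apply: cvgB; [exact: cY|exact: cX].
  - exact: cGZ.
split.
- exact: (gap_cont id (fun=> t) (fun=> y) G (fun=> G t) (fun=> G y)).
- exact: (gap_cont (fun=> x) id (fun=> y) (fun=> G x) G (fun=> G y)).
- exact: (gap_cont (fun=> x) (fun=> t) id (fun=> G x) (fun=> G t) G).
Qed.

(** The three points are freed one after the other, the middle one first, so
    that each step is a density argument in a single variable. *)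
Lemma chord_gap_le_rat a b G c : {within `[a, b], continuous G} ->
  (forall p q r : rat, a < ratr p -> ratr p < ratr q :> R ->
    ratr q < ratr r :> R -> ratr r < b ->
    chord_gap G (ratr p) (ratr q) (ratr r) <= (ratr r - ratr p) * c) ->
  forall x t y, a <= x -> x < t -> t < y -> y <= b ->
    chord_gap G x t y <= (y - x) * c.
Proof.
move=> cG ratG.
pose D : set R := range (@ratr R).
have dD (u v : R) x y : u <= x -> x < y -> y <= v -> exists2 d, D d & x < d < y.
  move=> _ xy _; have [q] := rat_in_itvoo xy; rewrite in_itv/= => qxy.
  by exists (ratr q) => //; exists q.
have sub u v : a <= u -> v <= b -> {within `[u, v], continuous G}.
  move=> au vb; apply: continuous_subspaceW cG.
  by apply: subset_itv; rewrite bnd_simp.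
have step1 p t r : D p -> D r -> a < p -> p < t -> t < r -> r < b ->
    chord_gap G p t r <= (r - p) * c.
  move=> Dp Dr ap pt tr rb; rewrite -subr_le0.
  have [_ cz _] := within_continuous_chord c p t r (sub p r (ltW ap) (ltW rb)).
  apply: (continuous_le_dense (lt_trans pt tr) cz (dD _ _)); last first.
    by rewrite in_itv/= !ltW.
  case: Dp Dr => p' _ E [r' _ E']; rewrite -{}E -{}E' in ap pt tr rb cz *.
  by move=> _ [q _ <-] pq qr; rewrite subr_le0; exact: ratG.
have step2 p t y : D p -> a < p -> p < t -> t < y -> y <= b ->
    chord_gap G p t y <= (y - p) * c.
  move=> Dp ap pt ty yb; rewrite -subr_le0.
  have tb := lt_le_trans ty yb.
  have [_ _ cz] := within_continuous_chord c p t y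
    (sub t b (ltW (lt_trans ap pt)) (lexx b)).
  apply: (continuous_le_dense tb cz (dD _ _)); last by rewrite in_itv/= yb ltW.
  by move=> r Dr tr rb; rewrite subr_le0; exact: step1.
move=> x t y ax xt ty yb; rewrite -subr_le0.
have at_ := le_lt_trans ax xt.
have [cz _ _] := within_continuous_chord c x t y
  (sub a t (lexx a) (ltW (lt_le_trans ty yb))).
apply: (continuous_le_dense at_ cz (dD _ _)); last by rewrite in_itv/= ax ltW.
by move=> p Dp ap pt; rewrite subr_le0; exact: step2.
Qed.

Lemma lt_sup_gapP a b G c : a < b -> {within `[a, b], continuous G} -> 0 <= c ->
  c < sup_gap a b G <->
  exists pqr : rat * rat * rat, let: (p, q, r) := pqr in
    [/\ a < ratr p, ratr p < ratr q :> R, ratr q < ratr r :> R, ratr r < b &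
     (ratr r - ratr p) * c < chord_gap G (ratr p) (ratr q) (ratr r)].
Proof.
move=> ab cG c0; split.
  move=> cgap; apply: contrapT => nrat; move: cgap; apply/negP; rewrite -leNgt.
  apply: (sup_gap_le (ltW ab) cG c0).
  apply: chord_gap_le_rat => // p q r ap pq qr rb.
  by rewrite leNgt; apply/negP => H; apply: nrat; exists (p, q, r).
move=> [[[p q] r] [ap pq qr rb H]].
rewrite -(ltr_pM2l (_ : 0 < ratr r - ratr p)); last first.
  by rewrite subr_gt0 (lt_trans pq).
rewrite (lt_le_trans H)//.
exact: (chord_gap_le_sup_gap (ltW ab) cG (ltW ap) (ltW pq) (ltW qr) (ltW rb)).
Qed.

Lemma measurable_fun_of_gt d (T : measurableType d) (f : T -> R) :
  (forall c, measurable [set w | c < f w]) -> measurable_fun setT f.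
Proof.
move=> mf mD; apply: (measurability _ (RGenOInfty.measurableE R)) => //.
move=> _ [_ [c ->] <-]; rewrite setTI; have := mf c; congr measurable.
by apply/seteqP; split=> w /=; rewrite in_itv/= andbT.
Qed.

Lemma measurable_gt d (T : measurableType d) (f : T -> R) c :
  measurable_fun setT f -> measurable [set w | c < f w].
Proof.
by move=> mf; rewrite -[X in measurable X]setTI -preimage_itvoy; apply: mf.
Qed.

Lemma measurable_sup_gap d (T : measurableType d) (X : R -> T -> R) a b :
  a < b -> (forall t, t \in `[a, b] -> measurable_fun setT (X t)) ->
  (forall w, {within `[a, b], continuous (X ^~ w)}) ->
  measurable_fun setT (fun w => sup_gap a b (X ^~ w)).
Proof.
move=> ab mX cX; apply: measurable_fun_of_gt => c.
have [c0|c0] := ltP c 0.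
  rewrite [X in measurable X](_ : _ = setT)//; apply/seteqP; split=> w //= _.
  exact: lt_le_trans (sup_gap_ge0 ab (cX w)).
pose A (pqr : rat * rat * rat) : set T := let: (p, q, r) := pqr in
  if [&& a < ratr p, ratr p < ratr q :> R, ratr q < ratr r :> R & ratr r < b]
  then [set w | (ratr r - ratr p) * c <
                chord_gap (X ^~ w) (ratr p) (ratr q) (ratr r)]
  else set0.
rewrite [X in measurable X](_ : _ = \bigcup_pqr A pqr); last first.
  apply/seteqP; split=> w /=.
    move=> /(lt_sup_gapP ab (cX w) c0)[[[p q] r] [ap pq qr rb H]].
    by exists (p, q, r) => //=; rewrite ap pq qr rb.
  move=> [[[p q] r] _ /=]; case: ifPn => // /and4P[ap pq qr rb] H.
  by apply/(lt_sup_gapP ab (cX w) c0); exists (p, q, r).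
apply: countable_bigcupT_measurable; first exact: countableP.
move=> [[p q] r] /=; case: ifPn => // /and4P[ap pq qr rb].
have mXat s : a < s -> s < b -> measurable_fun setT (X s).
  by move=> as_ sb; apply: mX; rewrite in_itv/= !ltW.
apply: measurable_gt.
apply: measurable_funB; [apply: measurable_funD|];
  apply: measurable_funM => //; apply: mXat => //.
- by rewrite (lt_trans pq)// (lt_trans qr).
- by rewrite (lt_trans ap)// (lt_trans pq).
- exact: lt_trans pq.
- exact: lt_trans rb.
Qed.

End Dense.

Section Grid.
Variable R : realType.
Implicit Types (stat : R -> R -> R).

Lemma grid_values_ubound n stat :
  has_ubound [set stat I.1 I.2 | I in @grid_intervals R n].
Proof.
exists (\sum_(i < n.+1) \sum_(j < n.+1) `|stat (i%:R / n%:R) (j%:R / n%:R)|).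
move=> _ [_ [[i j] /= /andP[ij jn] <-] <-] /=.
have i_n : (i < n.+1)%N by rewrite ltnS (leq_trans (ltnW ij)).
rewrite (bigD1 (Ordinal i_n))//= (bigD1 (Ordinal (jn : (j < n.+1)%N)))//=.
rewrite (le_trans (ler_norm _))// -addrA lerDl addr_ge0//.
  exact: sumr_ge0.
by apply: sumr_ge0 => k _; exact: sumr_ge0.
Qed.

Lemma grid_max_ge n stat i j : (i < j <= n)%N ->
  stat (i%:R / n%:R) (j%:R / n%:R) <= grid_max n stat.
Proof.
move=> ijn; apply: ub_le_sup; first exact: grid_values_ubound.
by exists (i%:R / n%:R, j%:R / n%:R) => //; exists (i, j).
Qed.

Lemma grid_max_gt n stat c : (0 < n)%N -> c < grid_max n stat ->
  exists2 ij : nat * nat, (ij.1 < ij.2 <= n)%N &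
    c < stat (ij.1%:R / n%:R) (ij.2%:R / n%:R).
Proof.
move=> n0 /sup_gt[|_ [_ [ij /= ijn <-] <-] cs]; last by exists ij.
exists (stat 0 (1 / n%:R)), (0, 1 / n%:R) => //.
by exists (0%N, 1%N); rewrite //= mul0r.
Qed.

Lemma measurable_grid_max d (T : measurableType d) n (stat : T -> R -> R -> R) :
  (0 < n)%N ->
  (forall i j, (i < j <= n)%N ->
    measurable_fun setT (fun w => stat w (i%:R / n%:R) (j%:R / n%:R))) ->
  measurable_fun setT (fun w => grid_max n (stat w)).
Proof.
move=> n0 mstat; apply: measurable_fun_of_gt => c.
pose A (ij : nat * nat) := if (ij.1 < ij.2 <= n)%N
  then [set w | c < stat w (ij.1%:R / n%:R) (ij.2%:R / n%:R)] else set0.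
rewrite [X in measurable X](_ : _ = \bigcup_ij A ij); last first.
  apply/seteqP; split=> w /=.
    by move=> /(grid_max_gt n0)[ij ijn H]; exists ij; rewrite // /A ijn.
  move=> [[i j] _]; rewrite /A; case: ifP => //= ijn H.
  by rewrite (lt_le_trans H)// grid_max_ge.
apply: countable_bigcupT_measurable; first exact: countableP.
move=> [i j]; rewrite /A; case: ifP => //= ijn.
by apply: measurable_gt; exact: mstat.
Qed.
End Grid.

(** * Gaussian tails *)

Section GaussianTail.
Variable R : realType.

(** Half of the exponent of the density already gives the decay in y; the other
    half is the density of the normal law of twice the variance, up to the
    ratio sqrt 2 <= 2 of the normalising constants. *)
Lemma normal_pdf_tail (s y x : R) : 0 < s -> 0 <= y -> y <= `|x| ->
  normal_pdf 0 s x <=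
  2 * expR (- (y ^+ 2 / (4 * s ^+ 2))) * normal_pdf 0 (Num.sqrt 2 * s) x.
Proof.
move=> s0 y0 yx.
have r2 : 0 < Num.sqrt 2 :> R by rewrite sqrtr_gt0.
rewrite !normal_pdfE ?mulf_neq0 ?gt_eqF//.
rewrite /normal_peak /normal_fun !subr0 exprMn sqr_sqrtr//.
have -> : 2 * s ^+ 2 * pi *+ 2 = 2 * (s ^+ 2 * pi *+ 2) :> R by ring.
rewrite sqrtrM//; set k := Num.sqrt (s ^+ 2 * pi *+ 2).
have k0 : 0 <= k^-1 by rewrite invr_ge0 sqrtr_ge0.
have e1 : expR (- x ^+ 2 / (s ^+ 2 *+ 2)) <=
    expR (- (y ^+ 2 / (4 * s ^+ 2))) * expR (- x ^+ 2 / (2 * s ^+ 2 *+ 2)).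
  rewrite -expRD ler_expR.
  have -> : - x ^+ 2 / (s ^+ 2 *+ 2) =
    - (x ^+ 2 / (4 * s ^+ 2)) + - x ^+ 2 / (2 * s ^+ 2 *+ 2).
    by field; rewrite gt_eqF.
  rewrite lerD2r lerN2 ler_wpM2r ?invr_ge0 ?mulr_ge0 ?sqr_ge0 ?(ltW s0)//.
  by rewrite -[leRHS](real_normK (num_real x)) lerXn2r ?nnegrE.
have e2 : 1 <= 2 * (Num.sqrt 2)^-1 :> R.
  rewrite ler_pdivlMr// mul1r -[leRHS]ger0_norm// -sqrtr_sqr ler_wsqrtr//.
  by rewrite -natrX ler_nat.
apply: (@le_trans _ _ (k^-1 * 1 * (expR (- (y ^+ 2 / (4 * s ^+ 2))) *
    expR (- x ^+ 2 / (2 * s ^+ 2 *+ 2))))).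
  by rewrite mulr1 ler_wpM2l.
rewrite (invfM (Num.sqrt 2) k) (_ : 2 * _ * (_ * _) =
    k^-1 * (2 * (Num.sqrt 2)^-1) * (expR (- (y ^+ 2 / (4 * s ^+ 2))) *
    expR (- x ^+ 2 / (2 * s ^+ 2 *+ 2)))); last by ring.
by rewrite ler_wpM2r ?mulr_ge0 ?expR_ge0// ler_wpM2l.
Qed.

Lemma normal_prob_tail (s y : R) : 0 < s -> 0 <= y ->
  (normal_prob 0 s [set x | (y < `|x|)%R] <=
   (2 * expR (- (y ^+ 2 / (4 * s ^+ 2))))%:E)%E.
Proof.
move=> s0 y0; set k := 2 * _.
have k0 : 0 <= k by rewrite mulr_ge0// expR_ge0.
have mV : measurable [set x : R | y < `|x|].
  by apply: measurable_gt; exact: normr_measurable.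
pose s' := Num.sqrt 2 * s.
rewrite /normal_prob.
apply: (@le_trans _ _ (\int[lebesgue_measure]_(x in [set x | (y < `|x|)%R])
    (k%:E * (normal_pdf 0 s' x)%:E))%E).
  apply: ge0_le_integral => //.
  - by move=> x _; rewrite lee_fin normal_pdf_ge0.
  - by apply/measurable_EFinP/measurable_funTS; exact: measurable_normal_pdf.
  - apply: emeasurable_funM => //.
    by apply/measurable_EFinP/measurable_funTS; exact: measurable_normal_pdf.
  - by move=> x /= yx; rewrite -EFinM lee_fin normal_pdf_tail// ltW.
rewrite ge0_integralZl_EFin//.
- rewrite -[leRHS]mule1 lee_pmul//; last first.
    exact: (probability_le1 (normal_prob 0 s')).
  by apply: integral_ge0 => x _; rewrite lee_fin normal_pdf_ge0.
- by move=> x _; rewrite lee_fin normal_pdf_ge0.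
- by apply/measurable_EFinP/measurable_funTS; exact: measurable_normal_pdf.
Qed.
End GaussianTail.

(** * Oscillation of Brownian paths by chaining *)

Section UnionBound.
Context (R : realType) (d : measure_display) (T : measurableType d).
Variable P : probability T R.

Lemma union_bound (A : set T) (F : nat -> set T) N (p : R) :
  measurable A -> (forall i, (i < N)%N -> measurable (F i)) ->
  (forall w, A w -> exists2 i, (i < N)%N & F i w) ->
  (forall i, (i < N)%N -> (P (F i) <= p%:E)%E) ->
  (P A <= (N%:R * p)%:E)%E.
Proof.
move=> mA mF AF Fp.
apply: (@le_trans _ _ (\sum_(i < N) P (F i))%E).
  apply: (content_subadditive P) => //.
  by rewrite -bigcup_mkord => w /AF[i iN Fi]; exists i.
apply: (@le_trans _ _ (\sum_(i < N) p%:E)%E).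
  by apply: lee_sum => i _; exact: Fp.
by rewrite sumEFin sumr_const card_ord mulr_natl.
Qed.
End UnionBound.

Section Chaining.
Variable R : realType.
Implicit Types (a b r : R) (w : R -> R).

Definition dyadic a b (k j : nat) : R := a + j%:R * ((b - a) / 2 ^+ k).

Lemma dyadic_double a b k j : dyadic a b k.+1 j.*2 = dyadic a b k j.
Proof.
rewrite /dyadic -mul2n natrM exprS; congr (_ + _).
by field; rewrite expf_neq0.
Qed.

Lemma dyadic_itv a b k j : a <= b -> (j <= 2 ^ k)%N -> a <= dyadic a b k j <= b.
Proof.
move=> ab jk; have m0 : 0 <= (b - a) / 2 ^+ k.
  by rewrite divr_ge0 ?exprn_ge0// subr_ge0.
rewrite /dyadic lerDl mulr_ge0//= addrC -lerBrDr mulrA ler_pdivrMr ?exprn_gt0//.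
by rewrite mulrC ler_wpM2l ?subr_ge0// -natrX ler_nat.
Qed.

Lemma dyadicS a b k j :
  dyadic a b k j.+1 - dyadic a b k j = (b - a) / 2 ^+ k.
Proof. by rewrite /dyadic -natr1; ring. Qed.

Lemma dyadic_between a b u v : a <= u -> u < v -> v <= b ->
  exists k j, (j <= 2 ^ k)%N /\ u < dyadic a b k j < v.
Proof.
move=> au uv vb; have ab : a < b by rewrite (le_lt_trans au)// (lt_le_trans uv).
pose x := (b - a) / (v - u); pose k := Num.bound x.
have xk : x < 2 ^+ k by apply: upper_nthrootP.
pose m := (b - a) / 2 ^+ k.
have m0 : 0 < m by rewrite divr_gt0 ?exprn_gt0// subr_gt0.
have muv : m < v - u.
  rewrite ltr_pdivrMr ?exprn_gt0// mulrC.
  by move: xk; rewrite ltr_pdivrMr ?subr_gt0.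
have : 0 <= (u - a) / m by rewrite divr_ge0 ?subr_ge0// ltW.
move=> /truncn_itv; set i := Num.truncn _.
rewrite ler_pdivlMr// ltr_pdivrMr// => /andP[iu ui].
have dv : u < dyadic a b k i.+1 < v.
  rewrite /dyadic -/m; apply/andP; split; first lra.
  by rewrite -natr1; lra.
exists k, i.+1; split=> //.
move: dv => /andP[_ dv].
have : dyadic a b k i.+1 <= b by rewrite ltW// (lt_le_trans dv).
rewrite /dyadic addrC -lerBrDr mulrA ler_pdivrMr ?exprn_gt0// mulrC.
by rewrite ler_pM2l ?subr_gt0// -natrX ler_nat.
Qed.

(** The right-hand side is r times the sum of (3/4)^i over i <= k: a point of
    level k + 1 is at most one cell of that level away from a point of level
    k. *)
Lemma dyadic_chaining a b r w :
  (forall k j, (j < 2 ^ k)%N ->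
    `|w (dyadic a b k j.+1) - w (dyadic a b k j)| <= r * (3 / 4) ^+ k) ->
  forall k j, (j <= 2 ^ k)%N ->
    `|w (dyadic a b k j) - w a| <= 4 * r * (1 - (3 / 4) ^+ k.+1).
Proof.
move=> Hinc; have r0 : 0 <= r.
  by have := Hinc 0%N 0%N isT; rewrite expr0 mulr1; exact: le_trans.
have d0 : dyadic a b 0 0 = a by rewrite /dyadic mul0r addr0.
elim=> [|k IH] j jk.
  move: j jk => [|[|//]] _; last first.
    by have := Hinc 0%N 0%N isT; rewrite d0 expr0 expr1; lra.
  by rewrite d0 subrr normr0 expr1; lra.
have q0 : 0 <= (3 / 4 : R) ^+ k.+1 by rewrite exprn_ge0.
have rq0 : 0 <= r * (3 / 4 : R) ^+ k.+1 by rewrite mulr_ge0.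
have E : (3 / 4 : R) ^+ k.+2 = 3 / 4 * (3 / 4) ^+ k.+1 by rewrite exprS.
have even_case i : (i <= 2 ^ k)%N ->
    `|w (dyadic a b k.+1 i.*2) - w a| <= 4 * r * (1 - (3 / 4) ^+ k.+1).
  by move=> ik; rewrite dyadic_double IH.
have jE := odd_double_half j; move: jE jk; set i := j./2.
case: (odd j) => /= <- jk.
  have ik : (i <= 2 ^ k)%N by move: jk; rewrite expnS; lia.
  have ik' : (i.*2 < 2 ^ k.+1)%N by move: jk; rewrite expnS; lia.
  have := Hinc k.+1 i.*2 ik'; have := even_case i ik; rewrite add1n.
  have := ler_distD (w (dyadic a b k.+1 i.*2))
    (w (dyadic a b k.+1 i.*2.+1)) (w a).
  by rewrite E; lra.
have ik : (i <= 2 ^ k)%N by move: jk; rewrite expnS; lia.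
by have := even_case i ik; rewrite add0n E; lra.
Qed.

Lemma chaining a b r w : a < b -> {within `[a, b], continuous w} ->
  (forall k j, (j < 2 ^ k)%N ->
    `|w (dyadic a b k j.+1) - w (dyadic a b k j)| <= r * (3 / 4) ^+ k) ->
  forall t, t \in `[a, b] -> `|w t - w a| <= 4 * r.
Proof.
move=> ab cw Hinc; have r0 : 0 <= r.
  by have := Hinc 0%N 0%N isT; rewrite expr0 mulr1; exact: le_trans.
pose D : set R := [set x | exists k j, (j <= 2 ^ k)%N /\ x = dyadic a b k j].
apply: (@continuous_le_dense R D) => //.
- move=> z; have := cw z => cwz.
  by apply: (@cvg_norm _ R^o); apply: cvgB; [exact: cwz|exact: cvg_cst].
- move=> x y ax xy yb; have [k [j [jk H]]] := dyadic_between ax xy yb.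
  by exists (dyadic a b k j) => //; exists k, j.
- move=> _ [k [j [jk ->]]] _ _.
  rewrite (le_trans (dyadic_chaining Hinc jk))//.
  rewrite ler_piMr ?mulr_ge0// lerBlDr lerDl exprn_ge0//.
Qed.

Lemma sup_gap_oscillation a b r w : a < b -> {within `[a, b], continuous w} ->
  0 <= r -> (forall t, t \in `[a, b] -> `|w t - w a| <= r) ->
  sup_gap a b w <= 2 * r.
Proof.
move=> ab cw r0 Hr; apply: (sup_gap_le (ltW ab) cw) => [|x t y ax xt ty yb].
  by rewrite mulr_ge0.
have osc u : a <= u -> u <= b -> - r <= w u - w a <= r.
  by move=> au ub; rewrite -ler_norml Hr// in_itv/= au.
have /andP[_ wx] : - r <= w x - w a <= r.
  by rewrite osc// ltW// (lt_trans xt)// (lt_le_trans ty).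
have /andP[_ wy] : - r <= w y - w a <= r.
  by rewrite osc// ltW// (le_lt_trans ax)// (lt_trans xt).
have /andP[wt _] : - r <= w t - w a <= r.
  by rewrite osc// ltW//; [rewrite (le_lt_trans ax)|rewrite (lt_le_trans ty)].
rewrite /chord_gap.
have -> : (y - t) * w x + (t - x) * w y - (y - x) * w t =
   (y - t) * (w x - w t) + (t - x) * (w y - w t) by ring.
have -> : (y - x) * (2 * r) = (y - t) * (2 * r) + (t - x) * (2 * r) by ring.
by apply: lerD; apply: ler_wpM2l; lra.
Qed.

End Chaining.

Section Brownian.
Context (R : realType) (d : measure_display) (T : measurableType d).
Variables (P : probability T R) (W : R -> T -> R).
Hypothesis bmW : brownian_motion01 P W.

Lemma bm_continuous_sub (a b : R) w : 0 <= a -> b <= 1 ->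
  {within `[a, b], continuous (W ^~ w)}.
Proof.
move=> a0 b1; have sub01 : `[a, b] `<=` `[0, 1].
  by apply: subset_itv; rewrite bnd_simp.
by apply: (continuous_subspaceW sub01) => x; exact: (bm_continuous bmW).
Qed.

Lemma bm_increment_measurable (s t y : R) : s \in `[0, 1] -> t \in `[0, 1] ->
  measurable [set w | y < `|W t w - W s w|].
Proof.
move=> s01 t01.
apply: measurable_gt; apply: measurableT_comp => //.
by apply: measurable_funB; exact: (bm_measurable bmW).
Qed.

Lemma bm_increment_tail (s t y : R) : 0 <= s -> s < t -> t <= 1 -> 0 <= y ->
  (P [set w | (y < `|W t w - W s w|)%R] <=
   (2 * expR (- (y ^+ 2 / (4 * (t - s)))))%:E)%E.
Proof.
move=> s0 st t1 y0.
have -> : [set w | (y < `|W t w - W s w|)%R] =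
  (fun w => W t w - W s w) @^-1` [set x | (y < `|x|)%R] by [].
rewrite (bm_gaussian bmW s0 st t1); last first.
  by apply: measurable_gt; exact: normr_measurable.
have ts : 0 < t - s by rewrite subr_gt0.
rewrite (le_trans (normal_prob_tail _ y0)) ?sqrtr_gt0//.
by rewrite sqr_sqrtr// ltW.
Qed.

(** With ratio 9/8 = 2 (3/4)^2 between consecutive exponents, Bernoulli's
    inequality leaves a factor exp (- u / 8) ^ k, which pays for the 2 ^ k
    cells of level k and for a geometric decay 2 ^ (- k). *)
Lemma geometric_tail_le (u : R) k : 0 <= u -> expR (- (u / 8)) <= 4^-1 ->
  2 ^+ k * (2 * expR (- (u * (9 / 8) ^+ k))) <= 4 * expR (- u) / (2 ^ k.+1)%:R.
Proof.
move=> u0 u4.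
have bern : 1 + k%:R / 8 <= (9 / 8 : R) ^+ k.
  elim: k => [|k IH]; first by rewrite expr0 mul0r addr0.
  rewrite exprS -natr1; move: IH; have : 0 <= k%:R :> R by []; lra.
have e : expR (- (u * (9 / 8) ^+ k)) <= expR (- u) * (4^-1) ^+ k.
  apply: (@le_trans _ _ (expR (- u) * expR (- (u / 8)) ^+ k)); last first.
    by rewrite ler_wpM2l ?expR_ge0// lerXn2r ?nnegrE ?expR_ge0.
  rewrite -expRM_natl -expRD ler_expR.
  have := ler_wpM2l u0 bern; lra.
apply: (@le_trans _ _ (2 ^+ k * (2 * (expR (- u) * 4^-1 ^+ k)))).
  by rewrite ler_wpM2l ?exprn_ge0// ler_wpM2l.
rewrite natrX le_eqVlt; apply/orP; left; apply/eqP.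
have -> : (4 : R) = 2 * 2 by ring.
rewrite invfM exprMn exprVn exprS.
by field; rewrite expf_neq0.
Qed.

(** Chaining at scale r = 2 sqrt u sqrt (b - a): the probability that some
    increment of level k exceeds r (3/4)^k is bounded with
    [geometric_tail_le], and these bounds sum to 4 exp (- u). *)
Lemma bm_sup_gap_tail (a b u : R) : 0 <= a -> a < b -> b <= 1 -> 0 <= u ->
  expR (- (u / 8)) <= 4^-1 ->
  (P [set w | (16 * Num.sqrt u * Num.sqrt (b - a) < sup_gap a b (W ^~ w))%R]
   <= (4 * expR (- u))%:E)%E.
Proof.
move=> a0 ab b1 u0 u4.
have sub01 : `[a, b] `<=` `[0, 1] by apply: subset_itv; rewrite bnd_simp.
have cW w : {within `[a, b], continuous (W ^~ w)} by exact: bm_continuous_sub.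
have mgap : measurable_fun setT (fun w => sup_gap a b (W ^~ w)).
  by apply: measurable_sup_gap => // t /sub01; exact: (bm_measurable bmW).
set r := 2 * Num.sqrt u * Num.sqrt (b - a).
have r0 : 0 <= r by rewrite !mulr_ge0// sqrtr_ge0.
have d01 k j : (j <= 2 ^ k)%N -> dyadic a b k j \in `[0, 1].
  move=> jk; apply: sub01; rewrite /= in_itv/=.
  by apply: dyadic_itv => //; exact: ltW.
pose B k j : set T := [set w | r * (3 / 4) ^+ k <
   `|W (dyadic a b k j.+1) w - W (dyadic a b k j) w|].
have mB k j : (j < 2 ^ k)%N -> measurable (B k j).
  by move=> jk; apply: bm_increment_measurable; apply: d01 => //; exact: ltnW.
have PB k j : (j < 2 ^ k)%N ->
    (P (B k j) <= (2 * expR (- (u * (9 / 8) ^+ k)))%:E)%E.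
  move=> jk; have m0 : 0 < (b - a) / 2 ^+ k.
    by rewrite divr_gt0 ?exprn_gt0// subr_gt0.
  have lt_d : dyadic a b k j < dyadic a b k j.+1 by rewrite -subr_gt0 dyadicS.
  have /andP[d0 _] : 0 <= dyadic a b k j <= 1 by apply: d01; exact: ltnW.
  have /andP[_ d1] : 0 <= dyadic a b k j.+1 <= 1 by exact: d01.
  apply: (le_trans (bm_increment_tail d0 lt_d d1 _)).
    by rewrite mulr_ge0 ?exprn_ge0.
  rewrite lee_fin ler_pM2l// ler_expR dyadicS lerN2 le_eqVlt.
  apply/orP; left; apply/eqP.
  have -> : (r * (3 / 4) ^+ k) ^+ 2 = 4 * u * (b - a) * ((3 / 4) ^+ 2) ^+ k.
    rewrite exprMn -exprM mulnC exprM; congr (_ * _).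
    by rewrite /r !exprMn !sqr_sqrtr ?subr_ge0 ?(ltW ab)//; ring.
  have -> : (9 / 8 : R) = (3 / 4) ^+ 2 * 2 by field.
  rewrite exprMn; field.
  by rewrite expf_neq0 // subr_eq0 gt_eqF.
pose A k := \bigcup_(j < 2 ^ k) B k j.
have mA k : measurable (A k) by apply: fin_bigcup_measurable => // j; exact: mB.
have PA k : (P (A k) <= (4 * expR (- u) / (2 ^ (k + 1))%:R)%:E)%E.
  apply: (@le_trans _ _ ((2 ^ k)%:R * (2 * expR (- (u * (9 / 8) ^+ k))))%:E).
    by apply: (union_bound (F := B k)) => // j; [exact: mB|exact: PB].
  by rewrite lee_fin natrX addn1 geometric_tail_le.
have sub : [set w | (16 * Num.sqrt u * Num.sqrt (b - a) <
    sup_gap a b (W ^~ w))%R] `<=` \bigcup_k A k.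
  move=> w /= gap; apply: contrapT => nA; move: gap; apply/negP; rewrite -leNgt.
  have -> : 16 * Num.sqrt u * Num.sqrt (b - a) = 2 * (4 * r).
    by rewrite /r; ring.
  apply: sup_gap_oscillation => //; first by rewrite mulr_ge0.
  apply: chaining => // k j jk; rewrite leNgt; apply/negP => H.
  by apply: nA; exists k => //; exists j.
apply: (le_trans (measure_sigma_subadditive P mA (measurable_gt _ mgap) sub)).
apply: (@le_trans _ _ (\sum_(k <oo) (4 * expR (- u) / (2 ^ (k + 1))%:R)%:E)%E).
  by apply: lee_nneseries => // k _; exact: PA.
have := cvg_lim _ (@cvg_geometric_eseries_half R (4 * expR (- u)) 0).
by rewrite expr0 divr1 => ->.
Qed.

End Brownian.

(** * The critical value is of order sqrt (ln n) *)

Section Quantile.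
Context (R : realType) (d : measure_display) (T : measurableType d).
Variable P : probability T R.

(** Nonnegativity bounds below the set whose infimum is the quantile; otherwise
    that infimum could be a default value. *)
Lemma quantile_le (p x : R) (X : T -> R) : 0 < p -> (forall w, 0 <= X w) ->
  (p%:E <= P [set w | (X w <= x)%R])%E -> quantile P p X <= x.
Proof.
move=> p0 X0 px; apply: ge_inf => //; exists 0 => y /= py.
rewrite leNgt; apply/negP => y0; move: py.
rewrite (_ : [set w | X w <= y] = set0); last first.
  by apply/seteqP; split=> w //= Xy; have := X0 w; lra.
by rewrite measure0 lee_fin leNgt p0.
Qed.

Variable W : R -> T -> R.
Hypothesis bmW : brownian_motion01 P W.

Lemma grid_point_itv n i j : (i < j <= n)%N ->
  [/\ 0 <= i%:R / n%:R :> R, i%:R / n%:R < j%:R / n%:R :> R &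
      j%:R / n%:R <= 1 :> R].
Proof.
move=> /andP[ij jn]; have n0 : 0 < n%:R :> R.
  by rewrite ltr0n (leq_trans _ jn)// (leq_trans _ ij).
split; first by rewrite divr_ge0.
  by rewrite ltr_pM2r ?invr_gt0// ltr_nat.
by rewrite ler_pdivrMr// mul1r ler_nat.
Qed.

Lemma noise_stat_measurable (a b : R) : 0 <= a -> a < b -> b <= 1 ->
  measurable_fun setT (fun w => noise_stat (W ^~ w) a b).
Proof.
move=> a0 ab b1; apply: measurable_funM => //.
apply: measurable_sup_gap => // [t tab|w]; last first.
  exact: (bm_continuous_sub bmW).
apply: (bm_measurable bmW); move: tab; rewrite !in_itv/= => /andP[at_ tb].
by rewrite (le_trans a0)// (le_trans tb).
Qed.

Lemma noise_stat_tail (a b u : R) : 0 <= a -> a < b -> b <= 1 -> 0 <= u ->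
  expR (- (u / 8)) <= 4^-1 ->
  (P [set w | (16 * Num.sqrt u < noise_stat (W ^~ w) a b)%R] <=
   (4 * expR (- u))%:E)%E.
Proof.
move=> a0 ab b1 u0 u4.
rewrite (_ : [set w | _] = [set w | (16 * Num.sqrt u * Num.sqrt (b - a) <
   sup_gap a b (W ^~ w))%R]); first exact: bm_sup_gap_tail.
apply: eq_set => w; rewrite /noise_stat [ltRHS]mulrC.
by rewrite ltr_pdivlMr// sqrtr_gt0 subr_gt0.
Qed.

Lemma noise_grid_max_measurable n : (0 < n)%N ->
  measurable_fun setT (fun w => grid_max n (noise_stat (W ^~ w))).
Proof.
move=> n0; apply: measurable_grid_max => // i j /grid_point_itv[a0 ab b1].
exact: noise_stat_measurable.
Qed.

Lemma noise_grid_max_ge0 n w : (0 < n)%N ->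
  0 <= grid_max n (noise_stat (W ^~ w)).
Proof.
move=> n0; have ijn : (0 < 1 <= n)%N by [].
have [a0 ab b1] := grid_point_itv ijn.
apply: le_trans (grid_max_ge _ ijn); rewrite mulr_ge0 ?invr_ge0 ?sqrtr_ge0//.
by apply: sup_gap_ge0 => //; exact: (bm_continuous_sub bmW).
Qed.

Lemma noise_grid_max_tail n (u : R) : (0 < n)%N -> 0 <= u ->
  expR (- (u / 8)) <= 4^-1 ->
  (P [set w | (16 * Num.sqrt u < grid_max n (noise_stat (W ^~ w)))%R] <=
   (n.+1%:R * (n.+1%:R * (4 * expR (- u))))%:E)%E.
Proof.
move=> n0 u0 u4; set x := 16 * _.
pose E i j : set T := if (i < j <= n)%N
  then [set w | x < noise_stat (W ^~ w) (i%:R / n%:R) (j%:R / n%:R)] else set0.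
have mE i j : measurable (E i j).
  rewrite /E; case: ifP => // /grid_point_itv[a0 ab b1].
  by apply: measurable_gt; exact: noise_stat_measurable.
have mF i : measurable (\bigcup_(j < n.+1) E i j).
  by apply: fin_bigcup_measurable => // j _.
apply: (union_bound (F := fun i => \bigcup_(j < n.+1) E i j)) => //.
- by apply: measurable_gt; exact: noise_grid_max_measurable.
- move=> w /= /(grid_max_gt n0)[[i j] /= ijn H]; have /andP[ij jn] := ijn.
  exists i; first by rewrite ltnS (leq_trans (ltnW ij)).
  by exists j => //=; rewrite /E ijn.
move=> i _; apply: (union_bound (F := E i)) => // j _.
rewrite /E; case: ifP => [/grid_point_itv[a0 ab b1]|_].
  exact: noise_stat_tail.
by rewrite measure0 lee_fin mulr_ge0// expR_ge0.
Qed.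

(** At u = (A + 16) ln n the tail is exp (- u) = n ^ - (A + 16).  Six powers of
    n pay for the factor 4 (n + 1) ^ 2 <= n ^ 6, and n ^ - A <= 2 ^ - A, which is
    at most alpha.  The value 16 ensures exp (- u / 8) <= n ^ - 2 <= 1 / 4. *)
Lemma s_quantile_le (alpha : R) n A :
  0 < alpha -> alpha < 1 -> 2^-1 ^+ A <= alpha -> (2 <= n)%N ->
  s_quantile P alpha n W <= 16 * Num.sqrt ((A + 16)%:R * ln n%:R).
Proof.
move=> alpha0 alpha1 Aalpha n2; have n0 : (0 < n)%N by exact: leq_trans n2.
have nR0 : 0 < n%:R :> R by rewrite ltr0n.
have ln0 : 0 <= ln (n%:R : R) by rewrite ln_ge0// ler1n.
set u := (A + 16)%:R * _.
have u0 : 0 <= u by rewrite mulr_ge0.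
have eu : expR (- u) = n%:R^-1 ^+ (A + 16).
  by rewrite -mulrN expRM_natl expRN lnK ?posrE.
have n2R : n%:R^-1 <= 2^-1 :> R by rewrite lef_pV2 ?posrE// ler_nat.
have nV0 : 0 <= n%:R^-1 :> R by rewrite invr_ge0.
have u4 : expR (- (u / 8)) <= 4^-1.
  apply: (@le_trans _ _ (n%:R^-1 ^+ 2)).
    rewrite -[n%:R^-1](lnK _) ?posrE ?invr_gt0// -expRM_natl ler_expR.
    rewrite lnV ?posrE// mulrN lerN2 /u natrD.
    have : 0 <= A%:R * ln n%:R :> R by rewrite mulr_ge0.
    lra.
  by rewrite (_ : 4^-1 = 2^-1 ^+ 2 :> R) ?lerXn2r ?nnegrE//; field.
have tail : n.+1%:R * (n.+1%:R * (4 * expR (- u))) <= alpha.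
  have n1 : n.+1%:R <= n%:R ^+ 2 :> R.
    by rewrite -natrX ler_nat expnS expn1; nia.
  have four : 4 <= n%:R ^+ 2 :> R by rewrite -natrX ler_nat expnS expn1; nia.
  apply: (@le_trans _ _ (n%:R ^+ 2 * (n%:R ^+ 2 * (n%:R ^+ 2 * expR (- u))))).
    have e0 := expR_ge0 (- u).
    apply: ler_pM; [by []|by rewrite !mulr_ge0|by []|].
    by apply: ler_pM; [|rewrite mulr_ge0| |rewrite ler_wpM2r].
  rewrite eu (_ : (A + 16 = A + (6 + 10))%N)//.
  have cancel (v k : R) : v != 0 ->
      v ^+ 2 * (v ^+ 2 * (v ^+ 2 * (k * (v^-1 ^+ 6 * v^-1 ^+ 10)))) =
      k * v^-1 ^+ 10.
    by move=> v0; field.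
  rewrite exprD exprD cancel ?gt_eqF//.
  have n10 : n%:R^-1 ^+ 10 <= 1 :> R by rewrite exprn_ile1// invf_le1// ler1n.
  rewrite (le_trans _ Aalpha)// (le_trans (ler_piMr _ n10)) ?exprn_ge0//.
  by rewrite lerXn2r ?nnegrE.
apply: quantile_le => [|w|]; [by rewrite subr_gt0|exact: noise_grid_max_ge0|].
rewrite (_ : [set w | _] =
    ~` [set w | 16 * Num.sqrt u <
                grid_max n (noise_stat (W ^~ w))]); last first.
  by apply/seteqP; split=> w /=; rewrite leNgt => /negP.
rewrite probability_setC; last first.
  by apply: measurable_gt; exact: noise_grid_max_measurable.
rewrite EFinB; apply: leeB => //.
by rewrite (le_trans (noise_grid_max_tail n0 u0 u4))// lee_fin.
Qed.
End Quantile.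

(** * Chord gap of the primitive of f *)

Section Primitive.
Variable R : realType.

Definition primitive (f : R -> R) (s : R) : R :=
  \int[lebesgue_measure]_(x in `[0, s]) f x.

Variables (f f' : R -> R).
Hypothesis C1f : C1_on01 f f'.

Lemma C1_is_derive (x : R) : 0 < x -> x < 1 -> is_derive x 1 f (f' x).
Proof.
move=> x0 x1; have x01 : x \in `[0, 1] by rewrite in_itv/= !ltW.
have /cvgrPdist_lt cq := C1f.2 x x01.
suff H : h^-1 *: (f (h *: 1 + x) - f x) @[h --> 0^'] --> f' x.
  by apply: DeriveDef; [apply/cvg_ex; exists (f' x)|exact: (cvg_lim _ H)].
apply/cvgrPdist_lt => e e0; have [r /= r0 Hr] := cq e e0.
exists (Num.min r (Num.min x (1 - x))) => /=.
  by rewrite !lt_min r0 x0 subr_gt0.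
move=> h /=; rewrite sub0r normrN !lt_min => /andP[hr /andP[hx hx1]] h0.
have /= := Hr (h *: 1 + x).
rewrite {1}(_ : h *: 1 + x = h + x); last by rewrite /GRing.scale/= mulr1.
rewrite opprD addrCA subrr addr0 normrN => /(_ hr).
have hx01 : `[0, 1]%classic (h *: 1 + x).
  move: hx hx1; rewrite !ltr_norml /= in_itv/= /GRing.scale/= mulr1.
  by move=> /andP[? ?] /andP[? ?]; apply/andP; split; lra.
have E : h *: 1 + x - x = h by rewrite addrK /GRing.scale/= mulr1.
move=> /(_ _ hx01); rewrite E mulrC; apply.
by apply: contra_neq h0 => H; rewrite -E H subrr.
Qed.

Lemma C1_within_continuous : {within `[0, 1], continuous f}.
Proof.
apply/subspace_continuousP => x x01.
have /cvgrPdist_lt /(_ 1 ltr01)[r /= r0 Hr] := C1f.2 x x01.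
apply/cvgrPdist_lt => e e0.
pose K := `|f' x| + 1; have K0 : 0 < K by rewrite ltr_wpDl.
exists (Num.min r (e / K)) => /=; first by rewrite lt_min r0 divr_gt0.
move=> y /=; rewrite lt_min ltr_pdivlMr// => /andP[xyr xye] y01.
rewrite /from_subspace.
have [->|yx] := eqVneq y x; first by rewrite subrr normr0.
have := Hr y xyr yx y01; set q := (f y - f x) / (y - x) => q1.
have yx0 : y - x != 0 by rewrite subr_eq0.
have -> : f x - f y = q * (x - y).
  by rewrite -[x - y]opprB mulrN /q divfK// opprB.
rewrite normrM (le_lt_trans _ xye)// mulrC ler_wpM2l//.
have := ler_distD (f' x) q 0; rewrite !subr0 distrC /K; lra.
Qed.

Local Notation G := (primitive f).

Lemma C1_integrable : lebesgue_measure.-integrable `[0, 1] (EFin \o f).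
Proof.
apply: continuous_compact_integrable; first exact: segment_compact.
exact: C1_within_continuous.
Qed.

Lemma primitive_continuous : {within `[0, 1], continuous G}.
Proof.
have := parameterized_integral_continuous ler01 C1_integrable.
exact.
Qed.

Lemma primitive_is_derive (x : R) : 0 < x -> x < 1 -> is_derive x 1 G (f x).
Proof.
move=> x0 x1.
have fx : {for x, continuous f}.
  have := C1_is_derive x0 x1 => -[df _].
  by apply: differentiable_continuous; apply/derivable1_diffP.
have [dG GE] := continuous_FTC1_closed x1 C1_integrable x0 fx.
by apply: DeriveDef; [exact: dG|rewrite -derive1E; exact: GE].
Qed.

Lemma primitive_mvt u v : 0 <= u -> u < v -> v <= 1 ->
  exists2 c, u < c < v & G v - G u = f c * (v - u).
Proof.
move=> u0 uv v1.
have dG x : x \in `]u, v[ -> is_derive x 1 G (f x).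
  by rewrite in_itv/= => /andP[ux xv]; apply: primitive_is_derive; lra.
have cG : {within `[u, v], continuous G}.
  apply: continuous_subspaceW primitive_continuous.
  by apply: subset_itv; rewrite bnd_simp.
by have [c cuv E] := MVT uv dG cG; exists c; first by move: cuv; rewrite in_itv.
Qed.

Lemma C1_slope_ge k u v : 0 <= u -> u <= v -> v <= 1 ->
  (forall x, x \in `[u, v] -> k <= f' x) -> k * (v - u) <= f v - f u.
Proof.
move=> u0 uv v1 kf.
have df x : x \in `]u, v[ -> is_derive x 1 f (f' x).
  by rewrite in_itv/= => /andP[ux xv]; apply: C1_is_derive; lra.
have cf : {within `[u, v], continuous f}.
  apply: continuous_subspaceW C1_within_continuous.
  by apply: subset_itv; rewrite bnd_simp.
have [c cuv ->] := MVT_segment uv df cf.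
by rewrite ler_wpM2r ?subr_ge0// kf.
Qed.

(** The mean value theorem is applied to the primitive on [t - r, t],
    [t, t + r / 2] and [t + r / 2, t + r]: the values of f at the intermediate
    points of the outer two intervals are at least r / 2 apart in the argument,
    hence differ by k r / 2.  Without the extra subdivision at t + r / 2 the
    intermediate points could both be close to t. *)
Lemma primitive_chord_gap k t r : 0 <= t - r -> t + r <= 1 -> 0 < r -> 0 <= k ->
  (forall x, x \in `[t - r, t + r] -> k <= f' x) ->
  k * r ^+ 3 / 4 <= chord_gap G (t - r) t (t + r).
Proof.
move=> tr0 tr1 r0 k0 kf.
have slope u v : t - r <= u -> u <= v -> v <= t + r -> k * (v - u) <= f v - f u.
  move=> tu uv vt; apply: C1_slope_ge => // [||x]; [lra|lra|].
  by rewrite in_itv/= => /andP[ux xv]; apply: kf; rewrite in_itv/=; lra.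
have [c1 /andP[c1l c1r] E1] : exists2 c, t - r < c < t &
    G t - G (t - r) = f c * (t - (t - r)).
  by apply: primitive_mvt; lra.
have [c2 /andP[c2l c2r] E2] : exists2 c, t < c < t + r / 2 &
    G (t + r / 2) - G t = f c * (t + r / 2 - t).
  by apply: primitive_mvt; lra.
have [c3 /andP[c3l c3r] E3] : exists2 c, t + r / 2 < c < t + r &
    G (t + r) - G (t + r / 2) = f c * (t + r - (t + r / 2)).
  by apply: primitive_mvt; lra.
have s12 : 0 <= f c2 - f c1.
  have c12 : k * (c2 - c1) <= f c2 - f c1 by apply: slope; lra.
  by rewrite (le_trans _ c12)// mulr_ge0//; lra.
have s13 : k * (r / 2) <= f c3 - f c1.
  have c13 : k * (c3 - c1) <= f c3 - f c1 by apply: slope; lra.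
  by rewrite (le_trans _ c13)// ler_wpM2l//; lra.
rewrite /chord_gap.
have -> : (t + r - t) * G (t - r) + (t - (t - r)) * G (t + r) -
    (t + r - (t - r)) * G t =
  r * (G (t + r) - G (t + r / 2) + (G (t + r / 2) - G t) - (G t - G (t - r))).
  by ring.
rewrite E1 E2 E3.
have -> : k * r ^+ 3 / 4 = r * (r / 2 * (k * (r / 2))) by field.
rewrite ler_pM2l//.
have -> : f c3 * (t + r - (t + r / 2)) + f c2 * (t + r / 2 - t) -
    f c1 * (t - (t - r)) =
  r / 2 * (f c3 - f c1) + r / 2 * (f c2 - f c1) by field.
rewrite -[leLHS]addr0; apply: lerD; first by rewrite ler_pM2l// divr_gt0.
by rewrite mulr_ge0// divr_ge0// ltW.
Qed.

End Primitive.

(** * Lower bound for the test statistic *)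

Section Power.
Variable R : realType.

(** Rounding v up as 1 minus a rounding down of 1 - v keeps the right endpoint
    within the grid, also when v = 1. *)
Lemma grid_cover (n : nat) (u v : R) : (0 < n)%N -> 0 <= u -> u < v -> v <= 1 ->
  exists i j, [/\ (i < j <= n)%N, i%:R / n%:R <= u, v <= j%:R / n%:R &
    j%:R / n%:R - i%:R / n%:R <= v - u + 2 / n%:R].
Proof.
move=> n0 u0 uv v1; have nR : 0 < n%:R :> R by rewrite ltr0n.
have /truncn_itv : 0 <= n%:R * u by rewrite mulr_ge0.
set i := Num.truncn _ => /andP[iu ui].
have /truncn_itv : 0 <= n%:R * (1 - v) by rewrite mulr_ge0 ?subr_ge0.
set k := Num.truncn _ => /andP[kv vk].
have kn : (k <= n)%N.
  rewrite -(ler_nat R) (le_trans kv)// ler_piMr//; lra.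
have iE : i%:R / n%:R <= u by rewrite ler_pdivrMr// mulrC.
have jE : v <= (n - k)%:R / n%:R by rewrite ler_pdivlMr// natrB//; lra.
exists i, (n - k)%N; split => //.
  rewrite leq_subr andbT -(ltr_nat R) -(ltr_pM2r (_ : 0 < n%:R^-1)) ?invr_gt0//.
  by rewrite (le_lt_trans iE)// (lt_le_trans uv).
rewrite -mulrBl ler_pdivrMr// natrB// mulrDl divfK ?gt_eqF//.
by move: ui vk; rewrite -!natr1; lra.
Qed.

Lemma chord_gapD (G H : R -> R) k x t y :
  chord_gap (fun s => G s + k * H s) x t y =
  chord_gap G x t y + k * chord_gap H x t y.
Proof. by rewrite /chord_gap; ring. Qed.

Lemma chord_gap_ge (w : R -> R) (t r y : R) : 0 <= r ->
  `|w t - w (t - r)| <= y -> `|w (t + r) - w t| <= y ->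
  - (2 * r * y) <= chord_gap w (t - r) t (t + r).
Proof.
move=> r0; rewrite !ler_norml => /andP[_ h1] /andP[h2 _].
have -> : chord_gap w (t - r) t (t + r) =
  r * ((w (t + r) - w t) - (w t - w (t - r))) by rewrite /chord_gap; ring.
have -> : - (2 * r * y) = r * (- y - y) by ring.
by rewrite ler_wpM2l// lerB.
Qed.

Section Observation.
Context (d : measure_display) (T : measurableType d) (P : probability T R).
Variables (W : R -> T -> R) (f f' : R -> R) (n : nat) (sigma : R).
Hypothesis bmW : brownian_motion01 P W.
Hypothesis C1f : C1_on01 f f'.

Let F w := observation n sigma f (W ^~ w).

Lemma observation_continuous a b w : 0 <= a -> b <= 1 ->
  {within `[a, b], continuous (F w)}.
Proof.
move=> a0 b1; have cW := bm_continuous_sub bmW (w := w) a0 b1.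
have cG : {within `[a, b], continuous (primitive f)}.
  apply: continuous_subspaceW (primitive_continuous C1f).
  by apply: subset_itv; rewrite bnd_simp.
move=> x; apply: cvgD; first exact: cG.
by apply: cvgM; [exact: cvg_cst|exact: cW].
Qed.

Lemma observation_measurable s : s \in `[0, 1] -> measurable_fun setT (F ^~ s).
Proof.
move=> s01; apply: measurable_funD => //.
by apply: measurable_funM => //; exact: (bm_measurable bmW).
Qed.

Lemma S_grid_max_measurable : (0 < n)%N ->
  measurable_fun setT (fun w => grid_max n (S_stat n sigma (F w))).
Proof.
move=> n0; apply: measurable_grid_max => // i j /(@grid_point_itv R)[a0 ab b1].
apply: measurable_funM => //.
apply: (@measurable_sup_gap R d T (fun s w => F w s)) => // [s sab|w].
  apply: observation_measurable; move: sab; rewrite !in_itv/= => /andP[as_ sb].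
  by rewrite (le_trans a0)// (le_trans sb).
exact: observation_continuous.
Qed.

Lemma bm_two_increments_tail (t r z : R) :
  0 < r -> 0 <= t - r -> t + r <= 1 -> 0 <= z ->
  (P [set w | (Num.sqrt r * z < `|W t w - W (t - r) w|) ||
              (Num.sqrt r * z < `|W (t + r) w - W t w|)]%R <=
   (4 * expR (- (z ^+ 2 / 4)))%:E)%E.
Proof.
move=> r0 tr0 tr1 z0; set y := Num.sqrt r * z.
have y0 : 0 <= y by rewrite mulr_ge0 ?sqrtr_ge0.
have I1 : t - r \in `[0, 1] by rewrite in_itv/=; lra.
have I2 : t \in `[0, 1] by rewrite in_itv/=; lra.
have I3 : t + r \in `[0, 1] by rewrite in_itv/=; lra.
pose B i : set T := if i == 0%N then [set w | y < `|W t w - W (t - r) w|]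
  else [set w | y < `|W (t + r) w - W t w|].
have mB i : measurable (B i).
  by rewrite /B; case: ifP => _; exact: (bm_increment_measurable bmW).
have yE : y ^+ 2 / (4 * r) = z ^+ 2 / 4.
  by rewrite exprMn sqr_sqrtr ?ltW//; field; rewrite gt_eqF.
rewrite (_ : [set w | _] = B 0%N `|` B 1%N); last first.
  by apply/seteqP; split => w /=; [move/orP|move=> ?; apply/orP].
have -> : 4 * expR (- (z ^+ 2 / 4)) = 2%:R * (2 * expR (- (z ^+ 2 / 4))).
  by ring.
apply: (union_bound (F := B)) => //.
- exact: measurableU.
- by move=> w [?|?]; [exists 0%N|exists 1%N].
move=> i _; rewrite -yE /B; case: ifP => _.
  have := @bm_increment_tail R d T P W bmW (t - r) t y.
  by rewrite (_ : t - (t - r) = r); [apply => //; lra|ring].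
have := @bm_increment_tail R d T P W bmW t (t + r) y.
by rewrite (_ : t + r - t = r); [apply => //; lra|ring].
Qed.

(** The chord gap at (t - r, t, t + r) splits into that of the primitive of f
    and that of the noise.  Since 2 r <= b - a <= 4 Delta, the normalisation
    turns the noise part into at most z and costs at most a factor 2 sqrt Delta in
    the signal part. *)
Lemma S_stat_ge (kappa t r z Delta a b : R) (w : T) :
  (0 < n)%N -> 0 < sigma -> 0 <= a -> b <= 1 ->
  0 < r -> 0 <= z -> 0 <= kappa -> r <= Delta ->
  a <= t - Delta -> t + Delta <= b -> b - a <= 4 * Delta ->
  (forall x, x \in `[t - r, t + r] -> kappa <= f' x) ->
  `|W t w - W (t - r) w| <= Num.sqrt r * z ->
  `|W (t + r) w - W t w| <= Num.sqrt r * z ->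
  Num.sqrt n%:R * (kappa * r ^+ 2) / (16 * sigma * Num.sqrt Delta) - z
    <= S_stat n sigma (F w) a b.
Proof.
move=> n0 s0 a0 b1 r0 z0 k0 rD aD Db ba kf W1 W2.
have D0 : 0 < Delta by exact: lt_le_trans rD.
have nR : 0 < n%:R :> R by rewrite ltr0n.
have L0 : 0 < b - a by lra.
have sn : 0 < Num.sqrt n%:R :> R by rewrite sqrtr_gt0.
have gapF : kappa * r ^+ 2 / 8 - sigma / Num.sqrt n%:R * (Num.sqrt r * z)
    <= sup_gap a b (F w).
  have ab : a <= b by lra.
  have := chord_gap_le_sup_gap ab (observation_continuous (w := w) a0 b1)
    (x := t - r) (t := t) (y := t + r).
  have -> : chord_gap (F w) (t - r) t (t + r) =
      chord_gap (primitive f) (t - r) t (t + r) +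
      sigma / Num.sqrt n%:R * chord_gap (W ^~ w) (t - r) t (t + r).
    exact: chord_gapD.
  have -> : t + r - (t - r) = 2 * r by ring.
  have h1 : a <= t - r by lra.
  have h2 : t - r <= t by lra.
  have h3 : t <= t + r by lra.
  have h4 : t + r <= b by lra.
  move=> /(_ h1 h2 h3 h4) gap.
  have pg : kappa * r ^+ 3 / 4 <= chord_gap (primitive f) (t - r) t (t + r).
    by apply: (primitive_chord_gap C1f) => //; lra.
  have wg := chord_gap_ge (w := W ^~ w) (ltW r0) W1 W2.
  have sn0 : 0 <= sigma / Num.sqrt n%:R by rewrite divr_ge0// ltW.
  have {}wg := ler_wpM2l sn0 wg.
  rewrite -(ler_pM2l (_ : 0 < 2 * r)); last by rewrite mulr_gt0.
  apply: le_trans gap; apply: le_trans (lerD pg wg).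
  rewrite le_eqVlt; apply/orP; left; apply/eqP; field.
  by rewrite gt_eqF.
rewrite /S_stat.
have -> : Num.sqrt (n%:R / (sigma ^+ 2 * (b - a))) =
    Num.sqrt n%:R / (sigma * Num.sqrt (b - a)).
  rewrite sqrtrM// sqrtrV; last by rewrite pmulr_lge0// sqr_ge0.
  by rewrite sqrtrM ?sqr_ge0// sqrtr_sqr gtr0_norm.
set l := Num.sqrt (b - a); set D := Num.sqrt Delta.
have l0 : 0 < l by rewrite sqrtr_gt0.
have D0' : 0 < D by rewrite sqrtr_gt0.
have lD : l <= 2 * D.
  have -> : 2 * D = Num.sqrt (4 * Delta).
    rewrite sqrtrM// (_ : 4 = 2 ^+ 2 :> R) ?sqrtr_sqr ?ger0_norm//.
    by rewrite -natrX.
  by rewrite ler_wsqrtr.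
have rl : Num.sqrt r <= l by rewrite ler_wsqrtr//; lra.
have c0 : 0 < Num.sqrt n%:R / (sigma * l) by rewrite divr_gt0// mulr_gt0.
apply: le_trans (ler_wpM2l (ltW c0) gapF).
have -> : Num.sqrt n%:R / (sigma * l) *
    (kappa * r ^+ 2 / 8 - sigma / Num.sqrt n%:R * (Num.sqrt r * z)) =
  Num.sqrt n%:R * (kappa * r ^+ 2) / (8 * sigma) * l^-1 - z * (Num.sqrt r / l).
  by field; rewrite !gt_eqF.
have -> : Num.sqrt n%:R * (kappa * r ^+ 2) / (16 * sigma * D) =
  Num.sqrt n%:R * (kappa * r ^+ 2) / (8 * sigma) * (2 * D)^-1.
  by field; rewrite !gt_eqF.
apply: lerB.
  apply: ler_wpM2l; last by rewrite lef_pV2// posrE mulr_gt0.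
  apply: divr_ge0; last by rewrite mulr_ge0// ltW.
  by apply: mulr_ge0; [exact: ltW|rewrite mulr_ge0// sqr_ge0].
by rewrite ler_piMr// ler_pdivrMr// mul1r.
Qed.

End Observation.
End Power.

(** The summand z / sqrt (ln 2) of the constant absorbs the additive loss z,
    because ln n >= ln 2, and the summand 1 makes the inequality strict. *)
Lemma signal_beats_threshold (R : realType) (n : nat) (sigma h D c z : R) :
  (2 <= n)%N -> 0 < sigma -> 0 < D -> 0 <= z ->
  16 * (c + z / Num.sqrt (ln 2) + 1) * Num.sqrt (sigma ^+ 2 * ln n%:R / n%:R)
    <= h / D ->
  c * Num.sqrt (ln n%:R) < Num.sqrt n%:R * h / (16 * sigma * D) - z.
Proof.
move=> n2 s0 D0 z0.
have nR : 0 < n%:R :> R by rewrite ltr0n (leq_trans _ n2).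
have sn : 0 < Num.sqrt n%:R :> R by rewrite sqrtr_gt0.
have ln2 : 0 < ln 2 :> R by rewrite ln_gt0// ltr1n.
have lnn : ln 2 <= ln n%:R :> R by rewrite ler_ln ?posrE// ler_nat.
have ln0 : 0 < ln n%:R :> R by exact: lt_le_trans lnn.
have -> : Num.sqrt (sigma ^+ 2 * ln n%:R / n%:R) =
    sigma * Num.sqrt (ln n%:R) / Num.sqrt n%:R.
  rewrite sqrtrM; last by rewrite mulr_ge0 ?sqr_ge0// ltW.
  by rewrite sqrtrV ?ltW// sqrtrM ?sqr_ge0// sqrtr_sqr gtr0_norm.
set L := Num.sqrt (ln n%:R); set L2 := Num.sqrt (ln 2); set N := Num.sqrt n%:R.
have L20 : 0 < L2 by rewrite sqrtr_gt0.
have L2L : L2 <= L by rewrite ler_wsqrtr.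
have L0 : 0 < L by exact: lt_le_trans L2L.
have zL : z <= z / L2 * L by rewrite -mulrA ler_peMr// mulrC ler_pdivlMr ?mul1r.
move=> /(ler_wpM2l (_ : 0 <= N / (16 * sigma))).
rewrite divr_ge0 ?mulr_ge0 ?(ltW s0) ?(ltW sn)// => /(_ isT).
have -> : N / (16 * sigma) * (16 * (c + z / L2 + 1) * (sigma * L / N)) =
  c * L + z / L2 * L + L by field; rewrite !gt_eqF.
have -> : N / (16 * sigma) * (h / D) = N * h / (16 * sigma * D).
  by field; rewrite !gt_eqF.
lra.
Qed.

Theorem corollary3p1 (R : realType) (alpha beta : R)
    (halpha : 0 < alpha < 1) (hbeta : 0 < beta < 1) :
  exists C : R, 0 < C /\
  forall (n : nat) (sigma : R) (f f' : R -> R) (t M lambda delta Delta : R)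
    (d : measure_display) (T : measurableType d) (P : probability T R)
    (W : R -> T -> R),
    (2 <= n)%N -> 0 < sigma ->
    brownian_motion01 P W ->
    C1_on01 f f' ->
    `[t - Delta, t + Delta] `<=` `[0, 1] ->
    0 < M -> 0 < lambda -> 0 < delta -> delta <= Delta ->
    (forall x, x \in `[t - Delta, t + Delta] -> 0 <= f' x) ->
    (forall x, x \in `[t - delta, t + delta] -> M * lambda <= f' x) ->
    n%:R^-1 <= Delta ->
    C * Num.sqrt (sigma ^+ 2 * ln n%:R / n%:R)
      <= M * delta ^+ 2 * lambda / Num.sqrt Delta ->
    ((1 - beta)%:E <=
      P [set w | (s_quantile P alpha n W <
                  grid_max n (S_stat n sigma
                    (observation n sigma f (W ^~ w))))%R])%E.

Proof.
have [a0 a1] := andP halpha; have [b0 b1] := andP hbeta.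
(* Any A with 2 ^ - A <= alpha would do. *)
pose A := Num.bound alpha^-1.
have Aalpha : 2^-1 ^+ A <= alpha.
  rewrite exprVn -[leRHS]invrK lef_pV2 ?posrE ?exprn_gt0 ?invr_gt0//.
  by rewrite ltW// upper_nthrootP.
(* Chosen so that the two increments of W exceed their bounds with probability
   at most 4 expR (- z ^ 2 / 4) = beta. *)
pose z : R := 2 * Num.sqrt (ln (4 / beta)).
have z0 : 0 <= z by rewrite mulr_ge0 ?sqrtr_ge0.
have b4 : 1 <= 4 / beta by rewrite ler_pdivlMr// mul1r; lra.
have zE : 4 * expR (- (z ^+ 2 / 4)) = beta.
  have -> : z ^+ 2 / 4 = ln (4 / beta).
    by rewrite exprMn sqr_sqrtr ?ln_ge0//; field.
  by rewrite expRN lnK ?posrE ?divr_gt0//; field; rewrite gt_eqF.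
have ln2 : 0 < ln 2 :> R by rewrite ln_gt0// ltr1n.
pose c : R := 16 * Num.sqrt (A + 16)%:R.
have c0 : 0 <= c by rewrite mulr_ge0 ?sqrtr_ge0.
exists (16 * (c + z / Num.sqrt (ln 2) + 1)); split.
  by rewrite mulr_gt0// ltr_wpDl// addr_ge0// divr_ge0 ?sqrtr_ge0.
move=> n sigma f f' t M lambda delta Delta d T P W n2 s0 bmW C1f sub01.
move=> M0 l0 d0 dD _ f'M nD signal.
have n0 : (0 < n)%N by exact: leq_trans n2.
have D0 : 0 < Delta by exact: lt_le_trans dD.
have tD0 : 0 <= t - Delta.
  have /sub01 : `[t - Delta, t + Delta]%classic (t - Delta).
    by rewrite /= in_itv/=; lra.
  by rewrite /= in_itv/= => /andP[].
have tD1 : t + Delta <= 1.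
  have /sub01 : `[t - Delta, t + Delta]%classic (t + Delta).
    by rewrite /= in_itv/=; lra.
  by rewrite /= in_itv/= => /andP[].
have tDD : t - Delta < t + Delta by lra.
have [i [j [ijn iE jE ij_len]]] := grid_cover n0 tD0 tDD tD1.
have [gi0 _ gj1] := grid_point_itv R ijn.
have len4 : j%:R / n%:R - i%:R / n%:R <= 4 * Delta.
  by rewrite (le_trans ij_len)//; lra.
have kappa0 : 0 <= M * lambda by rewrite mulr_ge0// ltW.
have beats : c * Num.sqrt (ln n%:R) <
    Num.sqrt n%:R * (M * lambda * delta ^+ 2) / (16 * sigma * Num.sqrt Delta)
    - z.
  apply: signal_beats_threshold => //; first by rewrite sqrtr_gt0.
  by rewrite (mulrAC M).
have quant : s_quantile P alpha n W <= c * Num.sqrt (ln n%:R).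
  rewrite /c -mulrA -sqrtrM//; exact: s_quantile_le.
have td0 : 0 <= t - delta by lra.
have td1 : t + delta <= 1 by lra.
have Bad := bm_two_increments_tail bmW d0 td0 td1 z0.
set B := [set w | _] in Bad.
have mB : measurable B.
  have I1 : t - delta \in `[0, 1] by rewrite in_itv/=; lra.
  have I2 : t \in `[0, 1] by rewrite in_itv/=; lra.
  have I3 : t + delta \in `[0, 1] by rewrite in_itv/=; lra.
  have -> : B = [set w | Num.sqrt delta * z < `|W t w - W (t - delta) w|] `|`
                [set w | Num.sqrt delta * z < `|W (t + delta) w - W t w|].
    by apply/seteqP; split => w /=; [move/orP|move=> ?; apply/orP].
  by apply: measurableU; exact: (bm_increment_measurable bmW).
apply: (@le_trans _ _ (P (~` B))).
  rewrite probability_setC// EFinB; apply: leeB => //.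
  by rewrite (le_trans Bad)// zE.
apply: le_measure; rewrite ?inE; first exact: measurableC.
  by apply: measurable_gt; exact: (S_grid_max_measurable sigma bmW C1f n0).
move=> w /= /negP; rewrite negb_or -!leNgt => /andP[W1 W2].
apply: (le_lt_trans quant); apply: (lt_le_trans beats).
apply: le_trans (grid_max_ge _ ijn).
by apply: (S_stat_ge bmW C1f (t := t) (Delta := Delta)).
Qed.
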